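(* Let $X$ be a LOTS, let $I$ be a set of indices, let $j\in I$, and let $\mathcal{L}_{X^I}$ be an interlocking nest in $X^I$. Suppose that whenever $L\in\mathcal{L}_{X^I}$ and $(x_i)_{i\in I}\in X^I$ with $(x_i)_{i\in I}\notin L$, then $x_j\notin\pi_j(L)$. Then $\pi_j(\mathcal{L}_{X^I})=\{\pi_j(L) : L\in\mathcal{L}_{X^I}\}$ is an interlocking nest in $X$.
   Context: A LOTS is a linearly ordered topological space (topology equal to the order topology of a linear order). A nest on a set is a family of its subsets that is linearly ordered by inclusion. $\pi_j:X^I\to X$ denotes the $j$-th canonical projection. A collection $\mathcal{S}\subset\mathcal{P}(Z)$ of subsets of a set $Z$ is interlocking if for each $T\in\mathcal{S}$ such that $T=\bigcap\{S : T\subset S,\ S\in\mathcal{S}-\{T\}\}$ we have $T=\bigcup\{S : S\subset T,\ S\in\mathcal{S}-\{T\}\}$. *)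

(* Defs.v *)
From mathcomp Require Import all_boot all_order.
From mathcomp Require Import all_classical topology.

Set Implicit Arguments.
Unset Strict Implicit.
Unset Printing Implicit Defensive.

Local Open Scope classical_set_scope.

Definition nest (Z : Type) (S : set (set Z)) : Prop := total_on S subset.

(* The intersection of the empty family is the ambient set Z, so a member of S
   that no other member contains satisfies the premise only when it is Z. *)
Definition interlocking (Z : Type) (S : set (set Z)) : Prop :=
  forall T : set Z, S T ->
    T = \bigcap_(A in [set A | T `<=` A /\ (S `\ T) A]) A ->
    T = \bigcup_(A in [set A | A `<=` T /\ (S `\ T) A]) A.

(* Main.v *)
Require Import Defs.
From mathcomp Require Import all_boot all_order.
From mathcomp Require Import all_classical topology.

(** The hypothesis on [L_XI] says that every member [L] is saturated for the
    projection, that is, [L] is the full preimage of its image. On saturated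
    sets the direct image preserves and reflects inclusion
    ([saturated_image_subset]), so it is an isomorphism of ordered families from
    [L_XI] onto its image, and membership of a point [x] in [L] is the same as
    membership of its projection in the image of [L]. Being a nest is a property
    of inclusion alone, and being interlocking is a property of inclusion
    together with intersections and unions of members, which are determined by
    these memberships ([interlocking_image]); both therefore pass to the image. The argument works for
    saturated families along an arbitrary function. *)

Local Open Scope classical_set_scope.

Definition saturated {Z Y : Type} (f : Z -> Y) (L : set Z) : Prop :=
  f @^-1` (f @` L) = L.

Lemma saturatedP {Z Y : Type} (f : Z -> Y) (L : set Z) :
  saturated f L <-> forall x, ~ L x -> ~ (f @` L) (f x).
Proof.
split=> [satL x nLx fLx|H]; first by apply: nLx; rewrite -satL.
apply/seteqP; split=> x; last exact: imageP.
by move=> fLx; apply: contrapT => /H.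
Qed.

Lemma saturated_image_subset {Z Y : Type} (f : Z -> Y) (A B : set Z) :
  saturated f B -> (f @` A `<=` f @` B) <-> (A `<=` B).
Proof.
move=> satB; split; last exact: image_subset.
by move=> fAB x Ax; rewrite -satB; apply: fAB; apply: imageP.
Qed.

Lemma saturated_image_inj {Z Y : Type} (f : Z -> Y) (A B : set Z) :
  saturated f A -> saturated f B -> f @` A = f @` B -> A = B.
Proof. by move=> satA satB fAB; rewrite -satA fAB satB. Qed.

Lemma nest_image {Z Y : Type} (f : Z -> Y) (S : set (set Z)) :
  nest S -> nest [set f @` L | L in S].
Proof.
move=> nestS _ _ [A SA <-] [B SB <-].
by case: (nestS A B SA SB) => AB; [left|right]; apply: image_subset.
Qed.

(** The premise at [f @` L] pulls back to the premise at [L], because a member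
    whose image contains [f @` L] itself contains [L]. The resulting union
    formula for [L] pushes forward, because members different from [L] have
    images different from [f @` L]. *)
Lemma interlocking_image {Z Y : Type} (f : Z -> Y) (S : set (set Z)) :
  (forall L, S L -> saturated f L) ->
  interlocking S -> interlocking [set f @` L | L in S].
Proof.
move=> satS intS _ [L SL <-] capL.
have satL := satS L SL.
have /(intS L SL) cupL :
    L = \bigcap_(A in [set A | L `<=` A /\ (S `\ L) A]) A.
  apply/seteqP; split=> [x Lx A [LA _]|x capx]; first exact: LA.
  suff: (f @` L) (f x) by move=> fLx; rewrite -satL.
  rewrite capL => _ [] /[swap] -[[A SA <-] neqAL] LB.
  apply: imageP; apply: capx; split; last by split=> // AL; apply: neqAL; rewrite AL.
  by apply/(saturated_image_subset f L A (satS A SA)).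
apply/seteqP; split=> [_ [x Lx <-]|y [B [BL _] By]]; last exact: BL.
move: Lx; rewrite {1}cupL => -[A [AL [SA neqAL]] Ax].
exists (f @` A); last exact: imageP.
split; first exact: image_subset.
split; first by exists A.
by move=> /(saturated_image_inj f A L (satS A SA) satL).
Qed.

Theorem theorem10 (d : Order.disp_t) (X : orderTopologicalType d) (I : Type)
    (j : I) (L_XI : set (set (I -> X))) :
  nest L_XI -> interlocking L_XI ->
  (forall (L : set (I -> X)) (x : I -> X),
     L_XI L -> ~ L x -> ~ (proj j @` L) (x j)) ->
  nest [set proj j @` L | L in L_XI] /\
  interlocking [set proj j @` L | L in L_XI].
Proof.
move=> nestL intL satL; split; first exact: nest_image.
apply: interlocking_image => // L LL.
by apply/saturatedP => x; apply: satL.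
Qed.
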